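(* Let $1<p<\infty$. The space $\mathscr{M}_p$ of multipliers of $\ell^p_A$, with the multiplier norm, fails to satisfy either of the Pythagorean inequalities for any parameters $r>1$ and $K>0$. That is, for every $r>1$ and $K>0$: it is not true that \[ \|\phi\|_{\mathscr{M}_p}^r+K\|\psi\|_{\mathscr{M}_p}^r\le\|\phi+\psi\|_{\mathscr{M}_p}^r \] for all $\phi,\psi\in\mathscr{M}_p$ with $\phi\perp_{\mathscr{M}_p}\psi$, and it is not true that \[ \|\phi\|_{\mathscr{M}_p}^r+K\|\psi\|_{\mathscr{M}_p}^r\ge\|\phi+\psi\|_{\mathscr{M}_p}^r \] for all $\phi,\psi\in\mathscr{M}_p$ with $\phi\perp_{\mathscr{M}_p}\psi$.
   Context: For $1\le p<\infty$, $\ell^p_A$ is the space of analytic functions $f(z)=\sum_{k\ge 0} f_k z^k$ on the open unit disk $\mathbb{D}$ whose Maclaurin coefficients are $p$-summable, with norm $\|f\|_p=(\sum_k|f_k|^p)^{1/p}$. An analytic function $\phi$ on $\mathbb{D}$ is a multiplier of $\ell^p_A$ if $\phi f\in\ell^p_A$ for every $f\in\ell^p_A$; the set of multipliers is denoted $\mathscr{M}_p$, with norm $\|\phi\|_{\mathscr{M}_p}=\sup\{\|\phi f\|_p: f\in\ell^p_A,\ \|f\|_p\le 1\}$. Orthogonality is in the Birkhoff-James sense: for vectors $x,y$ in a complex normed space $\mathscr{X}$, $x\perp_{\mathscr{X}}y$ means $\|x+\beta y\|_{\mathscr{X}}\ge\|x\|_{\mathscr{X}}$ for all scalars $\beta\in\mathbb{C}$.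 *)

(* Defs.v *)
From mathcomp Require Import all_boot all_order all_algebra.
From mathcomp Require Import all_classical all_reals all_analysis.
From mathcomp Require Import complex.

Set Implicit Arguments.
Unset Strict Implicit.
Unset Printing Implicit Defensive.

Import Order.TTheory GRing.Theory Num.Theory.
Import numFieldNormedType.Exports.

Local Open Scope classical_set_scope.
Local Open Scope complex_scope.
Local Open Scope ring_scope.

Definition disc (R : realType) := {z : R[i] | `|z| < 1}.

(* The topology is that of a numFieldType over itself, which has to be reached
   through an explicit cast for the concrete type R[i]. *)
Definition maclaurin_coefs (R : realType) (f : disc R -> R[i])
    (a : nat -> R[i]) : Prop :=
  forall z : disc R,
    (series (fun k => a k * val z ^+ k) : nat -> (R[i] : numFieldType)) @ \oo
      --> (f z : (R[i] : numFieldType)).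

Definition analytic (R : realType) (f : disc R -> R[i]) : Prop :=
  exists a, maclaurin_coefs f a.

(* The Maclaurin coefficients of an analytic function; zero otherwise. *)
Definition maclaurin (R : realType) (f : disc R -> R[i]) : nat -> R[i] :=
  xget (fun=> 0) [set a | maclaurin_coefs f a].

Definition lpA_norm (R : realType) (p : R) (f : disc R -> R[i]) : \bar R :=
  ((\sum_(0 <= k <oo) (Normc.normc (maclaurin f k) `^ p)%:E) `^ p^-1)%E.

Definition lpA (R : realType) (p : R) : set (disc R -> R[i]) :=
  [set f | analytic f /\
    (\sum_(0 <= k <oo) (Normc.normc (maclaurin f k) `^ p)%:E < +oo)%E].

Definition multiplier (R : realType) (p : R) : set (disc R -> R[i]) :=
  [set phi | analytic phi /\ forall f, lpA p f -> lpA p (phi \* f)].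

(* Extended-real valued, so that no finiteness is presupposed; it is finite on
   multipliers. *)
Definition multiplier_norm (R : realType) (p : R) (phi : disc R -> R[i]) :
    \bar R :=
  ereal_sup [set lpA_norm p (phi \* f) | f in
    [set f | lpA p f /\ (lpA_norm p f <= 1)%E]].

(* Orthogonality in the sense of Birkhoff and James. The norm N is a parameter,
   since multipliers are a subset of the module of all functions on the disc. *)
Definition BJ_orthogonal (R : realType) (X : lmodType R[i]) (N : X -> \bar R)
    (x y : X) : Prop :=
  forall beta : R[i], (N x <= N (x + beta *: y)%R)%E.

(* Main.v *)
(* Polynomials of degree one suffice.  The lower inequality fails for [z] and
   [1 - z]: their sum has norm 1, and [z] is orthogonal to [1 - z] because every
   combination [z + beta (1 - z)] takes the value 1 at [z = 1], while the norm
   of [a + b z] is at least [|a + b|].  The upper one fails for [1] and [e z]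
   with [e > 0] small: [1 + e z] has norm [1 + e], and as [r > 1],
   [(1 + e)^r >= 1 + e > 1 + K e^r]. *)
Require Import Defs.
From mathcomp Require Import all_boot all_order all_algebra.
From mathcomp Require Import all_classical all_reals all_analysis.
From mathcomp Require Import complex.
From mathcomp Require Import ring.

Import Order.TTheory GRing.Theory Num.Theory.
Import numFieldNormedType.Exports.

Local Open Scope classical_set_scope.
Local Open Scope complex_scope.
Local Open Scope ring_scope.

(** * Uniqueness of power series coefficients *)

Lemma sum_geometric_le2 (K : numFieldType) (s : K) n :
  0 <= s -> s <= 2^-1 -> \sum_(k < n) s ^+ k <= 2.
Proof.
move=> s0 s2; elim: n => [|n IH]; first by rewrite big_ord0.
rewrite big_ord_recl expr0.
under eq_bigr do rewrite /= /bump /= add1n exprS.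
rewrite -mulr_sumr -[leRHS]/(1 + 1) lerD2l.
apply: (le_trans (ler_pM s0 _ s2 IH)); last by rewrite mulVf ?pnatr_eq0.
by apply: sumr_ge0 => k _; rewrite exprn_ge0.
Qed.

(** Convergence at 1/2 bounds the terms there, so close to the origin everything after [d 0] is
    dominated by a small geometric series and cannot cancel [d 0]. The point [z = 0] is left out of
    the hypothesis so that it can be verified after a division by a power of [z]. *)
Lemma power_series_coef0 (K : numFieldType) (d : nat -> K) :
  (forall z : K, z != 0 -> `|z| < 1 ->
     (series (fun k => d k * z ^+ k) : nat -> K) @ \oo --> (0 : K)) ->
  d 0%N = 0.
Proof.
move=> dS.
have w0 : 2^-1 != 0 :> K by rewrite invr_eq0 pnatr_eq0.
have w1 : `|2^-1 : K| < 1.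
  by rewrite ger0_norm ?invr_ge0 ?ler0n// invf_lt1 ?ltr1n ?ltr0n.
have /cvg_ex/cvg_series_cvg_0 t0 : exists l : K,
    (series (fun k => d k * 2^-1 ^+ k) : nat -> K) @ \oo --> l.
  by exists 0; exact: dS.
have /cvg_seq_bounded/pinfty_ex_gt0[M M0 /= dM] :
    cvgn (fun k => d k * 2^-1 ^+ k : K).
  by apply/cvg_ex; exists 0.
apply: contrapT => /eqP d0.
have nd0 : 0 < `|d 0%N| by rewrite normr_gt0.
(* With [|d k| 2^-k <= M], the tail of the series at [s/2] is at most [2 M s],
   which this choice of [s] makes at most [|d 0| / 2]. *)
pose s : K := `|d 0%N| / (4 * (M + `|d 0%N|)).
have MD : 0 < M + `|d 0%N| by rewrite addr_gt0.
have D0 : 0 < 4 * (M + `|d 0%N|) by rewrite mulr_gt0 ?ltr0n.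
have s0 : 0 < s by rewrite divr_gt0.
(* The summand [|d 0|] next to [M] in the denominator of [s] makes this bound immediate. *)
have s2 : s <= 2^-1.
  rewrite /s ler_pdivrMr// mulrA -[_ * 4](_ : 2 = _); last by field.
  apply: (@le_trans _ _ (2 * `|d 0%N|)).
    by rewrite ler_peMl// ?ler1n// ltW.
  by rewrite ler_pM2l ?ltr0n// lerDr ltW.
have s1 : s < 1 by apply: (le_lt_trans s2); rewrite invf_lt1 ?ltr1n ?ltr0n.
have z0 : 2^-1 * s != 0 by rewrite mulf_neq0// gt_eqF.
have z1 : `|2^-1 * s| < 1.
  rewrite normrM (gtr0_norm s0) (ger0_norm (_ : 0 <= 2^-1)) ?invr_ge0 ?ler0n//.
  by rewrite mulr_ilt1 ?invr_ge0 ?ler0n ?(ltW s0)// invf_lt1 ?ltr1n ?ltr0n.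
(* Evaluating at [n.+1] instead of [n] ensures that the partial sum contains the term [d 0]. *)
have /cvgr_norm_lt/(_ (`|d 0%N| / 2)) := dS _ z0 z1.
rewrite normr0 divr_gt0 ?ltr0n// => /(_ isT)[n _ /(_ n.+1 (leqnSn n))/=].
rewrite seriesEord /= big_ord_recl expr0 mulr1; set T := \sum_(_ < _) _.
have TM : `|T| <= `|d 0%N| / 2.
  apply: (@le_trans _ _ (\sum_(i < n) (M * s) * s ^+ i)).
    apply: (le_trans (ler_norm_sum _ _ _)); apply: ler_sum => i _.
    rewrite /= /bump /= add1n exprMn mulrA normrM.
    rewrite (ger0_norm (exprn_ge0 _ (ltW s0))) -mulrA -exprS.
    by apply: ler_wpM2r; [rewrite exprn_ge0 ?ltW | exact: dM].
  rewrite -mulr_sumr.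
  have Ms : 0 <= M * s by rewrite mulr_ge0 ?ltW.
  apply: (le_trans (ler_wpM2l Ms (sum_geometric_le2 _ _ n (ltW s0) s2))).
  rewrite /s mulrA -mulrAC ler_pdivrMr//.
  have -> : `|d 0%N| / 2 * (4 * (M + `|d 0%N|)) =
      M * `|d 0%N| * 2 + 2 * `|d 0%N| ^+ 2.
    by field.
  by rewrite lerDl mulr_ge0// ?ler0n// exprn_ge0.
move=> /(le_lt_trans (lerB_normD _ _)).
rewrite ltrBlDr => /lt_le_trans/(_ (lerD (lexx _) TM)).
by rewrite -splitr ltxx.
Qed.

(** Strong induction: once the coefficients below [m] vanish, dividing by [z ^+ m] leaves a series
    with constant coefficient [c m], still converging to 0 away from the origin. *)
Lemma power_series_eq0 (K : numFieldType) (c : nat -> K) :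
  (forall z : K, `|z| < 1 ->
     (series (fun k => c k * z ^+ k) : nat -> K) @ \oo --> (0 : K)) ->
  forall k, c k = 0.
Proof.
move=> cS; elim/ltn_ind => m IH.
rewrite -[m]addn0; apply: (@power_series_coef0 K (fun k => c (m + k)%N)).
move=> z z0 z1.
have -> : (series (fun k => c (m + k)%N * z ^+ k) : nat -> K) =
    (fun n => z ^- m * series (fun k => c k * z ^+ k) (n + m)%N).
  apply/funext => n; rewrite !seriesEnat /=.
  rewrite [in RHS](big_cat_nat _ (n := m))//= ?leq_addl//.
  have -> : \sum_(0 <= i < m) c i * z ^+ i = 0.
    rewrite big_nat_cond big1// => i /andP[/andP[_ im] _].
    by rewrite IH ?mul0r.
  rewrite add0r.
  rewrite -[X in index_iota X (n + m)]add0n big_addn addnK mulr_sumr.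
  apply: eq_bigr => i _.
  by rewrite exprD addnC mulrCA [z ^+ i * _]mulrC mulKf// expf_neq0.
rewrite -[X in _ --> X](mulr0 (z ^- m)); apply: cvgMl_tmp.
rewrite (cvg_shiftn m (series (fun k => c k * z ^+ k) : nat -> K)); exact: cS.
Qed.

(** Since [maclaurin] is defined by choice, uniqueness is what allows any known expansion to compute
    it. *)
Lemma maclaurin_coefs_unique (R : realType) (f : disc R -> R[i]) a b :
  maclaurin_coefs f a -> maclaurin_coefs f b -> a = b.
Proof.
move=> fa fb; apply/funext => k; apply/eqP; rewrite -subr_eq0; apply/eqP.
apply: (@power_series_eq0 R[i] (fun k => a k - b k)) => z z1.
rewrite (_ : series _ =
    series (fun k => a k * z ^+ k) - series (fun k => b k * z ^+ k)).
  rewrite -(subrr (f (exist _ z z1))).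
  exact: cvgB (fa (exist _ z z1)) (fb (exist _ z z1)).
apply/funext => n; rewrite /series /= -[RHS]sumrB.
by apply: eq_bigr => i _; rewrite mulrBl.
Qed.

Lemma maclaurinE (R : realType) (f : disc R -> R[i]) a :
  maclaurin_coefs f a -> maclaurin f = a.
Proof.
move=> fa; apply: xget_unique => // b fb.
exact: maclaurin_coefs_unique fb fa.
Qed.

(** * Expansions of polynomials and of products with a factor of degree one *)

Lemma maclaurin_coefs_poly (R : realType) n (c : nat -> R[i]) :
  (forall k, (n <= k)%N -> c k = 0) ->
  maclaurin_coefs (fun z : disc R => \sum_(k < n) c k * val z ^+ k) c.
Proof.
move=> c0 z; apply: cvg_near_cst; exists n => // m /= nm.
rewrite /series /= (big_cat_nat _ (n := n))//= big_mkord.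
have -> : \sum_(n <= i < m) c i * sval z ^+ i = 0; last by rewrite addr0.
rewrite big_nat_cond big1// => k /andP[/andP[nk _] _].
by rewrite c0 ?mul0r.
Qed.

Definition mulX {V : nmodType} (c : nat -> V) k := if k is j.+1 then c j else 0.

Definition affine {R : realType} (a b : R[i]) : disc R -> R[i] :=
  fun z => a + b * val z.
Arguments affine {R} (a b)%_ring_scope _.

Lemma affineE (R : realType) (a b : R[i]) (k : R[i]) (a' b' : R[i]) :
  affine a b + k *: affine a' b' = affine (a + k * a') (b + k * b').
Proof.
apply/funext => z; rewrite /affine !fctE.
rewrite -[k *: _]/(k * (a' + b' * val z)); ring.
Qed.

Lemma maclaurin_coefs_affineM (R : realType) (a b : R[i]) f c :
  maclaurin_coefs f c ->
  maclaurin_coefs (affine a b \* f) (fun k => a * c k + b * mulX c k).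
Proof.
move=> fc z; rewrite /= mulrDl -mulrA.
(* At index [n.+1] the partial sum of the product is exactly [a * S n.+1 + b * (z * S n)], with no
   boundary term. *)
rewrite -(cvg_shiftS (_ : nat -> (R[i] : numFieldType))) /=.
have Sc := fc z; have Sc' := Sc.
rewrite -(cvg_shiftS (_ : nat -> (R[i] : numFieldType))) /= in Sc'.
set S := series (fun k => c k * val z ^+ k) in Sc Sc'.
rewrite (_ : (fun n => _) = (fun n => a * S n.+1 + b * (val z * S n))).
  apply: (cvgD (cvgMl_tmp (a := a) Sc') _).
  exact: (cvgMl_tmp (a := b) (cvgMl_tmp (a := val z) Sc)).
apply/funext => n; rewrite /S /series /= !mulr_sumr.
under eq_bigr do rewrite mulrDl.
rewrite big_split /=; congr (_ + _).
  by apply: eq_bigr => i _; rewrite mulrA.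
rewrite [LHS]big_nat_recl//= mulr0 mul0r add0r.
by apply: eq_bigr => i _; rewrite exprS; ring.
Qed.

(** * Sums of [p]-th powers of coefficients *)

Lemma normc_ge0 (R : realType) (x : R[i]) : 0 <= Normc.normc x.
Proof. by case: x => a b; exact: sqrtr_ge0. Qed.

Lemma normc_real (R : realType) (x : R) : 0 <= x -> Normc.normc x%:C = x.
Proof.
by move=> x0; rewrite /Normc.normc /= expr0n addr0 sqrtr_sqr ger0_norm.
Qed.

(** This is the [p]-th power of the norm, taken on coefficient sequences so that estimates can be
    made before extracting the root. *)
Definition lp_sum {R : realType} (p : R) (c : nat -> R[i]) : \bar R :=
  (\sum_(0 <= k <oo) (Normc.normc (c k) `^ p)%:E)%E.

Lemma normc_powR_ge0 (R : realType) (p : R) (x : R[i]) :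
  (0 <= (Normc.normc x `^ p)%:E)%E.
Proof. by rewrite lee_fin powR_ge0. Qed.

Lemma lp_sum_ge0 (R : realType) (p : R) (c : nat -> R[i]) :
  (0 <= lp_sum p c)%E.
Proof. by apply: nneseries_ge0 => *; exact: normc_powR_ge0. Qed.

Lemma lpA_normE (R : realType) (p : R) f (c : nat -> R[i]) :
  maclaurin_coefs f c -> lpA_norm p f = (lp_sum p c `^ p^-1)%E.
Proof. by move=> fc; rewrite /lpA_norm (maclaurinE _ _ _ fc). Qed.

Lemma lpA_normX (R : realType) (p : R) f (c : nat -> R[i]) :
  0 < p -> maclaurin_coefs f c -> (lpA_norm p f `^ p)%E = lp_sum p c.
Proof.
move=> p0 fc; rewrite (lpA_normE _ _ _ _ fc) -poweRrM mulVf ?gt_eqF//.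
by rewrite poweRe1// lp_sum_ge0.
Qed.

Lemma lpAP (R : realType) (p : R) f (c : nat -> R[i]) :
  maclaurin_coefs f c -> lpA p f <-> (lp_sum p c < +oo)%E.
Proof.
move=> fc; rewrite /lpA /= (maclaurinE _ _ _ fc); split=> [[]//|?].
by split => //; exists c.
Qed.

(** The condition [p != 0] matters because [powR] sends 0 with exponent 0 to 1, and zero
    coefficients must contribute nothing. *)
Lemma lp_sum_fin (R : realType) (p : R) n (c : nat -> R[i]) : p != 0 ->
  (forall k, (n <= k)%N -> c k = 0) ->
  lp_sum p c = (\sum_(k < n) Normc.normc (c k) `^ p)%:E.
Proof.
move=> p0 c0; rewrite /lp_sum (nneseries_split 0 n); last first.
  by move=> *; exact: normc_powR_ge0.
rewrite add0n [X in (_ + X)%E]eseries0 ?adde0 ?sumEFin ?big_mkord// => k nk _.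
by rewrite c0// Normc.normc0 powR0.
Qed.

Lemma lp_sum_mulX (R : realType) (p : R) (c : nat -> R[i]) : p != 0 ->
  lp_sum p (mulX c) = lp_sum p c.
Proof.
move=> p0; rewrite /lp_sum nneseries_recl//; last first.
  by move=> *; exact: normc_powR_ge0.
rewrite [Normc.normc (mulX c 0)]Normc.normc0 powR0// add0e.
rewrite -nneseries_addn; last first.
  by move=> *; exact: normc_powR_ge0.
by apply: eq_eseriesr => k _; rewrite addn1.
Qed.

Lemma lp_sumZ (R : realType) (p : R) a (c : nat -> R[i]) :
  lp_sum p (fun k => a * c k)%R = ((Normc.normc a `^ p)%:E * lp_sum p c)%E.
Proof.
rewrite /lp_sum -nneseriesZl; last by move=> *; exact: normc_powR_ge0.
by apply: eq_eseriesr => k _; rewrite Normc.normcM powRM ?normc_ge0.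
Qed.

(** The modulus of a sum is at most twice the larger modulus. The constant is crude, but only
    finiteness of sums is drawn from it. *)
Lemma normc_powRD (R : realType) (p : R) (x y : R[i]) : 0 <= p ->
  Normc.normc (x + y) `^ p <=
  2 `^ p * (Normc.normc x `^ p + Normc.normc y `^ p).
Proof.
move=> p0; wlog xy : x y / Normc.normc x <= Normc.normc y.
  by move=> H; case/orP: (le_total (Normc.normc x) (Normc.normc y)) => /H//;
    rewrite addrC [X in _ * X]addrC.
apply: (@le_trans _ _ ((2 * Normc.normc y) `^ p)).
  apply: ge0_ler_powR; rewrite ?nnegrE ?mulr_ge0 ?normc_ge0//.
  by apply: (le_trans (le_normcD _ _)); rewrite mulr_natl mulr2n lerD2r.
rewrite powRM ?normc_ge0// ler_wpM2l ?powR_ge0// lerDr powR_ge0//.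
Qed.

Lemma lp_sumD (R : realType) (p : R) (c d : nat -> R[i]) : 0 <= p ->
  (lp_sum p (fun k => c k + d k)%R <=
    (2 `^ p)%:E * (lp_sum p c + lp_sum p d))%E.
Proof.
move=> p0; rewrite /lp_sum -nneseriesD; last 2 first.
- by move=> *; exact: normc_powR_ge0.
- by move=> *; exact: normc_powR_ge0.
rewrite -nneseriesZl; last first.
  by move=> *; rewrite adde_ge0// normc_powR_ge0.
apply: lee_nneseries => [*|k _]; first exact: normc_powR_ge0.
by rewrite -EFinD -EFinM lee_fin normc_powRD.
Qed.

Lemma lp_sum_affine (R : realType) (p : R) a b (c : nat -> R[i]) : 0 < p ->
  (lp_sum p c < +oo)%E ->
  (lp_sum p (fun k => a * c k + b * mulX c k)%R < +oo)%E.
Proof.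
move=> p0 coo; apply: (le_lt_trans (lp_sumD _ _ _ _ (ltW p0))).
have p0' : p != 0 by rewrite gt_eqF.
rewrite !lp_sumZ lp_sum_mulX//.
rewrite lte_mul_pinfty ?lee_fin ?powR_ge0// lte_add_pinfty//;
  by rewrite lte_mul_pinfty ?lee_fin ?powR_ge0.
Qed.

(** * Multiplier norms of polynomials of degree at most one *)

Lemma multiplier_affine (R : realType) (p : R) (a b : R[i]) : 0 < p ->
  multiplier p (affine a b).
Proof.
move=> p0; split.
  pose c k : R[i] := if k is j.+1 then (if j is _.+1 then 0 else b) else a.
  exists c; rewrite (_ : affine a b = fun z => \sum_(k < 2) c k * val z ^+ k).
    by apply: maclaurin_coefs_poly => -[|[]].
  by apply/funext => z; rewrite !big_ord_recr big_ord0 /= add0r mulr1.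
move=> f /[dup] -[[c fc] _] /(lpAP _ _ _ _ fc) coo.
apply/(lpAP _ _ _ _ (maclaurin_coefs_affineM _ a b f c fc)).
exact: lp_sum_affine.
Qed.

(** The hypothesis makes multiplication by [affine a b] equal to [m] times an isometry in effect on
    norms. It serves the two cases where [a] or [b] is zero. *)
Lemma multiplier_norm_affine_le (R : realType) (p : R) (a b : R[i]) (m : R) :
  0 < p -> 0 <= m ->
  (forall c : nat -> R[i],
    lp_sum p (fun k => a * c k + b * mulX c k)%R =
    ((m `^ p)%:E * lp_sum p c)%E) ->
  (multiplier_norm p (affine a b) <= m%:E)%E.
Proof.
move=> p0 m0 abm; apply: ge_ereal_sup => _ [f [[[c fc] _]] f1 <-].
rewrite (lpA_normE _ _ _ _ (maclaurin_coefs_affineM _ a b f c fc)) abm.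
rewrite poweRM ?lp_sum_ge0 ?lee_fin ?powR_ge0//.
rewrite -(lpA_normE _ _ _ _ fc) poweR_EFin -powRrM divff ?gt_eqF// powRr1//.
by rewrite -[leRHS]mule1 lee_wpmul2l.
Qed.

Lemma multiplier_norm_const_le (R : realType) (p : R) (a : R[i]) : 0 < p ->
  (multiplier_norm p (affine a 0) <= (Normc.normc a)%:E)%E.
Proof.
move=> p0; apply: multiplier_norm_affine_le; rewrite ?normc_ge0// => c.
by rewrite -lp_sumZ; congr lp_sum; apply/funext => k; rewrite mul0r addr0.
Qed.

Lemma multiplier_norm_monomial_le (R : realType) (p : R) (b : R[i]) : 0 < p ->
  (multiplier_norm p (affine 0 b) <= (Normc.normc b)%:E)%E.
Proof.
move=> p0; apply: multiplier_norm_affine_le; rewrite ?normc_ge0// => c.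
rewrite -(lp_sum_mulX _ p c) ?gt_eqF// -lp_sumZ; congr lp_sum.
by apply/funext => k; rewrite mul0r add0r.
Qed.

(** The supremum of an empty set would be [-oo], so a test function must be exhibited. It is the
    zero function, written as an empty sum to fit [maclaurin_coefs_poly]. *)
Lemma multiplier_norm_ge0 (R : realType) (p : R) (a b : R[i]) :
  0 < p -> (0 <= multiplier_norm p (affine a b))%E.
Proof.
move=> p0; have p0' : p != 0 by rewrite gt_eqF.
have z0 : maclaurin_coefs
    (fun z : disc R => \sum_(k < 0) 0 * val z ^+ k) (fun=> 0).
  exact: maclaurin_coefs_poly.
have s0 : lp_sum p (fun=> 0 : R[i]) = 0%E.
  by rewrite (lp_sum_fin _ _ 0)// big_ord0.
apply: (le_trans (poweR_ge0 _ _)); apply: ereal_sup_ubound.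
eexists; last by rewrite /lpA_norm.
by split; [apply/(lpAP _ _ _ _ z0); rewrite s0|
  rewrite (lpA_normE _ _ _ _ z0) s0 poweR0r ?invr_eq0].
Qed.

(* Obtained by testing on [(n+1)^(-1/p) (1 + z + ... + z^n)], of norm 1. *)
Lemma multiplier_norm_affine_test (R : realType) (p : R) (a b : R[i]) n :
  0 < p ->
  (((Normc.normc a `^ p + n%:R * Normc.normc (a + b) `^ p) / n.+1%:R)%:E
    <= multiplier_norm p (affine a b) `^ p)%E.
Proof.
move=> p0; have p0' : p != 0 by rewrite gt_eqF.
pose c k : R[i] := if (k < n.+1)%N then (n.+1%:R^-1 `^ p^-1)%:C else 0.
have c0 k : (n < k)%N -> c k = 0 by move=> nk; rewrite /c ltnNge nk.
have cp k : (k < n.+1)%N -> Normc.normc (c k) `^ p = n.+1%:R^-1.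
  move=> kn; rewrite /c kn normc_real ?powR_ge0// -powRrM mulVf// powRr1//.
have fc := maclaurin_coefs_poly R n.+1 c c0; set f := (fun z => _) in fc.
have c1 : lp_sum p c = 1%E.
  rewrite (lp_sum_fin _ _ n.+1)// (eq_bigr (fun=> n.+1%:R^-1)) => [|k _].
    by rewrite sumr_const card_ord -[X in X%:E]mulr_natr mulVf ?pnatr_eq0.
  by rewrite cp.
have af := maclaurin_coefs_affineM _ a b f c fc.
apply: (@le_trans _ _ (lpA_norm p (affine a b \* f)%R `^ p)%E); last first.
  apply: gt0_ler_poweR; rewrite ?(ltW p0)// ?in_itv/= ?leey ?andbT ?poweR_ge0//.
    exact: multiplier_norm_ge0.
  apply: ereal_sup_ubound; exists f => //; split.
    by apply/(lpAP _ _ _ _ fc); rewrite c1 ltry.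
  by rewrite (lpA_normE _ _ _ _ fc) c1 poweR1r.
rewrite (lpA_normX _ _ _ _ p0 af).
(* Up to the factor in [c], the product has coefficients [a], then [n] times [a + b], then [b].
   Truncating at [n.+1] terms drops the last one. *)
apply: le_trans (nneseries_lim_ge n.+1 _); last first.
  by move=> *; exact: normc_powR_ge0.
rewrite sumEFin lee_fin big_mkord big_ord_recl /=.
rewrite mulr0 addr0 Normc.normcM powRM ?normc_ge0// cp//.
rewrite mulrDl lerD2l.
rewrite (eq_bigr (fun=> Normc.normc (a + b) `^ p / n.+1%:R)) => [|k _].
  by rewrite sumr_const card_ord -[leRHS]mulr_natl mulrA.
have kn : (k < n.+1)%N by rewrite ltnW// ltnS.
rewrite (_ : c (bump 0 k) = c k); last first.
  by rewrite /c kn /bump /= add1n ltnS ltn_ord.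
by rewrite -mulrDl Normc.normcM powRM ?normc_ge0// cp.
Qed.

(** This is the case [n = 0], where the test function is the constant 1. *)
Lemma multiplier_norm_affine_ge (R : realType) (p : R) (a b : R[i]) : 0 < p ->
  ((Normc.normc a)%:E <= multiplier_norm p (affine a b))%E.
Proof.
move=> p0; have := multiplier_norm_affine_test R p a b 0 p0.
have := multiplier_norm_ge0 R p a b p0.
case: (multiplier_norm _ _) => [m| |]//; last by move=> *; rewrite leey.
rewrite poweR_EFin !lee_fin => m0.
rewrite mul0r addr0 divr1 leNgt [in X in _ -> X]leNgt; apply: contra => ma.
by apply: gt0_ltr_powR; rewrite ?nnegrE ?normc_ge0.
Qed.

(** As [n] grows, the test bounds tend to the [p]-th power of the modulus of [a + b], the value at
    [z = 1]. *)
Lemma multiplier_norm_affine_ge_sum (R : realType) (p : R) (a b : R[i]) :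
  0 < p ->
  ((Normc.normc (a + b))%:E <= multiplier_norm p (affine a b))%E.
Proof.
move=> p0; have := multiplier_norm_affine_test R p a b ^~ p0.
have := multiplier_norm_ge0 R p a b p0.
case: (multiplier_norm _ _) => [m| |]//; last by move=> *; rewrite leey.
rewrite poweR_EFin !lee_fin => m0 H; rewrite leNgt; apply/negP => mab.
have {mab} d0 : 0 < Normc.normc (a + b) `^ p - m `^ p.
  by rewrite subr_gt0; apply: gt0_ltr_powR; rewrite ?nnegrE ?normc_ge0.
(* The limit is replaced by one large [n]. With [s] the [p]-th power of the modulus of [a + b] and
   [t] that of [m], it satisfies [t < n (s - t)], whereas the test gives [n s <= (n + 1) t]. *)
have := Num.Theory.archi_boundP (divr_ge0 (powR_ge0 m p) (ltW d0)).
set n := Num.bound _; rewrite ltr_pdivrMr// mulrBr ltrBrDr ltNge.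
move=> /negP; apply.
move: (H n); rewrite lee_fin ler_pdivrMr ?ltr0n// -[n.+1%:R]natr1 mulrDr mulr1.
rewrite [m `^ p * _]mulrC [X in _ <= X]addrC; apply: le_trans.
by rewrite lerDr powR_ge0.
Qed.

(** * Failure of both inequalities *)

Lemma small_powR_lt (R : realType) (r K : R) : 1 < r -> 0 < K ->
  exists2 e : R, 0 < e & K * e `^ r < e.
Proof.
move=> r1 K0; have r10 : 0 < r - 1 by rewrite subr_gt0.
have K20 : 0 < (2 * K)^-1 by rewrite invr_gt0 mulr_gt0.
(* This [e] solves [K e^(r-1) = 1/2], so that [K e^r = e/2]. *)
exists ((2 * K)^-1 `^ (r - 1)^-1); first by rewrite powR_gt0.
set e := (X in _ < X); have e0 : 0 < e by rewrite powR_gt0.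
rewrite -mulr_powRB1 ?(ltW e0) ?(lt_trans ltr01)// mulrCA.
rewrite -powRrM mulVf ?gt_eqF// powRr1 ?(ltW K20)//.
have -> : K * (2 * K)^-1 = 2^-1 by field; rewrite gt_eqF.
by rewrite gtr_pMr// invf_lt1// ltr1n.
Qed.

Theorem theorem5p5 (R : realType) (p : R) (hp : 1 < p)
    (r K : R) (hr : 1 < r) (hK : 0 < K) :
  ~ (forall phi psi : disc R -> R[i],
       multiplier p phi -> multiplier p psi ->
       BJ_orthogonal (multiplier_norm p) phi psi ->
       (multiplier_norm p phi `^ r + K%:E * multiplier_norm p psi `^ r
          <= multiplier_norm p (phi + psi)%R `^ r)%E)
  /\
  ~ (forall phi psi : disc R -> R[i],
       multiplier p phi -> multiplier p psi ->
       BJ_orthogonal (multiplier_norm p) phi psi ->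
       (multiplier_norm p (phi + psi)%R `^ r
          <= multiplier_norm p phi `^ r + K%:E * multiplier_norm p psi `^ r)%E).
Proof.
have p0 : 0 < p := lt_trans ltr01 hp.
have r0 : 0 <= r := ltW (lt_trans ltr01 hr).
have mult a b := multiplier_affine R p a b p0.
have poweR_le (x y : \bar R) : (0 <= x -> x <= y -> x `^ r <= y `^ r)%E.
  move=> x0 xy; apply: gt0_ler_poweR; rewrite // in_itv/= leey ?x0//.
  by rewrite (le_trans x0).
have affineD (a b a' b' : R[i]) :
    affine a b + affine a' b' = affine (a + a') (b + b').
  by rewrite -[affine a' b']scale1r affineE !mul1r.
have const1 : (multiplier_norm p (@affine R 1 0) <= 1)%E.
  by rewrite (le_trans (multiplier_norm_const_le _ _ _ p0))// Normc.normc1.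
split=> H.
  have /H : BJ_orthogonal (multiplier_norm p) (@affine R 0 1) (affine 1 (- 1)).
    move=> beta; rewrite affineE.
    apply: (le_trans (multiplier_norm_monomial_le _ _ _ p0)).
    rewrite [X in Normc.normc X](_ : 1 = (0 + beta * 1) + (1 + beta * -1)).
      exact: multiplier_norm_affine_ge_sum.
    by ring.
  (* The sum is the constant 1, so the right side is at most 1. Both norms on the left are at least
     1, so that side is at least [1 + K]. *)
  move=> /(_ (mult _ _) (mult _ _)); rewrite affineD add0r subrr.
  move=> /le_trans/(_ (poweR_le _ _ (multiplier_norm_ge0 _ _ _ _ p0) const1)).
  apply/negP; rewrite -ltNge poweR1r.
  apply: (@lt_le_trans _ _ (1 + K%:E * 1)%E).
    by rewrite mule1 -EFinD lte_fin ltrDl.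
  apply: leeD; last apply: lee_wpmul2l; rewrite ?lee_fin ?(ltW hK)//.
    rewrite -(poweR1r r); apply: poweR_le => //.
    have := multiplier_norm_affine_ge_sum R p 0 1 p0.
    by rewrite add0r Normc.normc1.
  rewrite -(poweR1r r); apply: poweR_le => //.
  have := multiplier_norm_affine_ge R p 1 (- 1) p0.
  by rewrite Normc.normc1.
have [e e0 Ke] := small_powR_lt R r K hr hK.
have /H : BJ_orthogonal (multiplier_norm p) (@affine R 1 0) (affine 0 e%:C).
  (* Adding a multiple of [z] keeps the constant coefficient 1, which bounds the norm from below. *)
  move=> beta; rewrite affineE mulr0 addr0.
  apply: (le_trans const1).
  have := multiplier_norm_affine_ge R p 1 (0 + beta * e%:C) p0.
  by rewrite Normc.normc1.
move=> /(_ (mult _ _) (mult _ _)); rewrite affineD addr0 add0r.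
apply/negP; rewrite -ltNge.
(* The chain bounds the right side above by [1 + K e^r], passes strictly below [(1 + e)^r], and ends
   with the lower bound [1 + e] for the norm of the sum, its value at [z = 1]. *)
apply: (@le_lt_trans _ _ (1 + K%:E * (e%:E `^ r))%E).
  apply: leeD; last apply: lee_wpmul2l; rewrite ?lee_fin ?(ltW hK)//.
    rewrite -[leRHS](poweR1r r); apply: poweR_le => //.
    exact: multiplier_norm_ge0.
  apply: poweR_le; first exact: multiplier_norm_ge0.
  have := multiplier_norm_monomial_le R p e%:C p0.
  by rewrite normc_real// ltW.
apply: (@lt_le_trans _ _ ((1 + e)%:E `^ r)%E).
  rewrite !poweR_EFin -EFinM -EFinD lte_fin.
  apply: (@lt_le_trans _ _ (1 + e)); first by rewrite ltrD2l.
  by apply: le1r_powR; rewrite ?lerDl ?(ltW e0)// (ltW hr).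
apply: poweR_le; first by rewrite lee_fin addr_ge0// ltW.
have := multiplier_norm_affine_ge_sum R p 1 e%:C p0.
by rewrite -[X in X + _]/(1%:C) -rmorphD normc_real// addr_ge0// ltW.
Qed.
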